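(* Let $G$ be an ample Hausdorff groupoid and $K$ a field. If $A_K(G)$ is just infinite, then (1) $|G|_W|<\infty$ for every nonempty, closed, invariant and proper subset $W$ of $G^{(0)}$; (2) if $u\in G^{(0)}$ and $\overline{\mathcal O_u}\neq G^{(0)}$, then $|G_u^u|<\infty$; (3) every orbit is either dense in $G^{(0)}$ or finite. If, in addition, (4) $G^{(0)}$ is finite, then $G$ is transitive; (5) $G$ is second countable, then $G$ has a dense orbit; (6) $G$ satisfies Property (FIC), then $G$ is minimal. (Each of (4), (5), (6) is a separate implication, under the assumption that $A_K(G)$ is just infinite.)
   Context: An ample Hausdorff groupoid is a locally compact Hausdorff étale topological groupoid $G$ (range map $r$, source map $s$, unit space $G^{(0)}$) having a basis of compact open bisections, where a bisection is a set $U\subseteq G$ on which $r$ and $s$ are injective. The Steinberg algebra is $A_K(G)=\mathrm{span}_K\{1_U: U\subseteq G\text{ a compact open bisection}\}$ with convolution product, determined by $1_U*1_V=1_{UV}$. A $K$-algebra $A$ is just infinite if $\dim_K A=\infty$ and $\dim_K A/I<\infty$ for every nonzero (two-sided) ideal $I\subseteq A$. A set $W\subseteq G^{(0)}$ is invariant if $r(s^{-1}(W))=W$, and then $G|_W:=s^{-1}(W)\cap r^{-1}(W)$. The orbit of $u\in G^{(0)}$ is $\mathcal O_u=\{v\in G^{(0)}:\exists\gamma\in G,\ s(\gamma)=u,\ r(\gamma)=v\}$; the isotropy group at $u$ is $G_u^u=\{\gamma\in G:r(\gamma)=s(\gamma)=u\}$. $G$ is transitive if it has exactly one orbit, and minimal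 if every orbit is dense in $G^{(0)}$. $G$ satisfies Property (FIC) if every nonempty invariant subset $W\subseteq G^{(0)}$ with $|G|_W|<\infty$ is clopen in $G^{(0)}$. *)

(* Defs.v *)
From HB Require Import structures.
From mathcomp Require Import all_boot all_algebra.
From mathcomp Require Import all_classical all_reals all_analysis.

Set Implicit Arguments.
Unset Strict Implicit.
Unset Printing Implicit Defensive.

Import GRing.Theory.
Local Open Scope classical_set_scope.
Local Open Scope ring_scope.

Definition local_homeomorphism (X Y : topologicalType) (f : X -> Y) : Prop :=
  forall x : X, exists U : set X,
    [/\ open U, U x, open (f @` U) &
        exists g : Y -> X,
          [/\ {within U, continuous f},
              {within f @` U, continuous g} &
              forall y : X, U y -> g (f y) = y]].

(** Groupoids are single-sorted: objects are identified with their identity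
    arrows, so the source [gsrc] and the range [grng] are maps [G -> G] onto the
    units.  The total function [gmul x y] is only meaningful when
    [gsrc x = grng y]. *)
HB.mixin Record isGroupoid G := {
  gsrc : G -> G;
  grng : G -> G;
  gmul : G -> G -> G;
  ginv : G -> G;
  grng_src : forall x, grng (gsrc x) = gsrc x;
  gsrc_rng : forall x, gsrc (grng x) = grng x;
  gsrcM : forall x y, gsrc x = grng y -> gsrc (gmul x y) = gsrc y;
  grngM : forall x y, gsrc x = grng y -> grng (gmul x y) = grng x;
  gmulA : forall x y z, gsrc x = grng y -> gsrc y = grng z ->
    gmul x (gmul y z) = gmul (gmul x y) z;
  gmul_rng : forall x, gmul (grng x) x = x;
  gmul_src : forall x, gmul x (gsrc x) = x;
  gsrcV : forall x, gsrc (ginv x) = grng x;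
  grngV : forall x, grng (ginv x) = gsrc x;
  gmulxV : forall x, gmul x (ginv x) = grng x;
  gmulVx : forall x, gmul (ginv x) x = gsrc x
}.

#[short(type="groupoidType")]
HB.structure Definition Groupoid := {G of isGroupoid G}.

HB.structure Definition PreTopologicalGroupoid :=
  {G of Groupoid G & Topological G}.

HB.mixin Record isTopologicalGroupoid G of PreTopologicalGroupoid G := {
  gmul_continuous :
    {within [set p : G * G | gsrc p.1 = grng p.2],
       continuous (fun p : G * G => gmul p.1 p.2)};
  ginv_continuous : continuous (ginv : G -> G)
}.

#[short(type="topologicalGroupoidType")]
HB.structure Definition TopologicalGroupoid :=
  {G of isTopologicalGroupoid G & PreTopologicalGroupoid G}.

Definition units (G : groupoidType) : set G := [set x | gsrc x = x].

Lemma units_gsrc (G : groupoidType) (x : G) : units (gsrc x).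
Proof. by have := gsrc_rng (gsrc x); rewrite grng_src. Qed.

Lemma units_grng (G : groupoidType) (x : G) : units (grng x).
Proof. by rewrite /units/= gsrc_rng. Qed.

(** The carrier of [set_type] has the subspace topology inherited from [G]. *)
Definition unit_space (G : topologicalGroupoidType) : topologicalType :=
  set_type (@units G).

Definition src (G : topologicalGroupoidType) (x : G) : unit_space G :=
  exist _ (gsrc x) (mem_set (units_gsrc x)).

Definition rng (G : topologicalGroupoidType) (x : G) : unit_space G :=
  exist _ (grng x) (mem_set (units_grng x)).

Definition bisection (G : topologicalGroupoidType) (U : set G) : Prop :=
  {in U &, injective (@rng G)} /\ {in U &, injective (@src G)}.

Definition compact_open_bisection (G : topologicalGroupoidType) (U : set G)
  : Prop := [/\ compact U, open U & bisection U].

Definition etale (G : topologicalGroupoidType) : Prop :=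
  local_homeomorphism (@rng G) /\ local_homeomorphism (@src G).

Definition ample_hausdorff (G : topologicalGroupoidType) : Prop :=
  [/\ locally_compact [set: G], hausdorff_space G, etale G &
      exists2 B : set (set G), basis B & B `<=` @compact_open_bisection G].

Section Dynamics.
Variable G : topologicalGroupoidType.
Implicit Types (u : unit_space G) (W : set (unit_space G)).

Definition invariant_set W : Prop := @rng G @` (@src G @^-1` W) = W.

Definition restriction W : set G := @src G @^-1` W `&` @rng G @^-1` W.

Definition groupoid_orbit u : set (unit_space G) :=
  [set v | exists x : G, src x = u /\ rng x = v].

Definition isotropy u : set G := [set x | rng x = u /\ src x = u].

Definition transitive_groupoid : Prop :=
  exists! O : set (unit_space G), range groupoid_orbit O.

Definition minimal_groupoid : Prop := forall u, dense (groupoid_orbit u).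

Definition property_FIC : Prop :=
  forall W, W !=set0 -> invariant_set W -> finite_set (restriction W) ->
    clopen W.

End Dynamics.

(** A possibly non-unital [K]-algebra is presented as a subset [A] of a
    [K]-vector space [V], with a product [mul] on [V] that is only relevant
    on [A]. *)
Section NonUnitalAlgebra.
Variables (K : fieldType) (V : lmodType K).
Implicit Types (A I B : set V).

Definition linear_span B : set V :=
  [set v | exists n (c : 'I_n -> K) (b : 'I_n -> V),
     (forall i, B (b i)) /\ v = \sum_(i < n) c i *: b i].

Definition finite_dim A : Prop := exists2 B, finite_set B & A = linear_span B.

(** [A / I] is spanned by the classes of finitely many elements of [A]. *)
Definition finite_dim_quotient A I : Prop :=
  exists B, [/\ finite_set B, B `<=` A &
    forall v, A v -> exists2 w, linear_span B w & I (v - w)].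

Record two_sided_ideal (mul : V -> V -> V) A I : Prop := {
  ideal_sub : I `<=` A;
  ideal0 : I 0;
  idealD : forall x y, I x -> I y -> I (x + y);
  idealZ : forall (c : K) x, I x -> I (c *: x);
  idealMl : forall a x, A a -> I x -> I (mul a x);
  idealMr : forall a x, A a -> I x -> I (mul x a)
}.

Definition just_infinite (mul : V -> V -> V) A : Prop :=
  ~ finite_dim A /\
  forall I, two_sided_ideal mul A I -> (exists2 x, I x & x != 0) ->
    finite_dim_quotient A I.

End NonUnitalAlgebra.

Section Steinberg.
Variables (K : fieldType) (G : topologicalGroupoidType).

Definition steinberg : set (G -> K^o) :=
  linear_span [set f | exists2 U : set G,
                 compact_open_bisection U & f = \1_U].

(** On [steinberg] the sum has finite support, because on each bisection at
    most one [p.1] has the range of [x]; a sum with infinite support is [0]. *)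
Definition convolution (f g : G -> K^o) : G -> K^o := fun x =>
  \sum_(p \in [set p : G * G | gsrc p.1 = grng p.2 /\ gmul p.1 p.2 = x])
     (f p.1 * g p.2 : K).

Lemma convolution_indic (U V : set G) : bisection U -> bisection V ->
  convolution \1_U \1_V =
  \1_[set x | exists a b, [/\ U a, V b, gsrc a = grng b & gmul a b = x]].
Proof.
move=> [rU _] [_ sV]; apply/funext => x; rewrite /convolution.
set P := [set p | _]; rewrite indicE.
case: (pselect (exists a b, [/\ U a, V b, gsrc a = grng b & gmul a b = x])).
- move=> xUV; rewrite mem_set//; have [a [b [Ua Vb ab abx]]] := xUV.
  rewrite -(@fsbig_widen _ _ _ _ [set (a, b)]).
  + by rewrite fsbig_set1 !indicE !mem_set// mulr1.
  + by move=> _ ->; split.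
  + move=> [a' b'] /= [[/= ab' abx'] nab].
    rewrite !indicE; case: (boolP (a' \in U)) => Ua'; last by rewrite mul0r.
    case: (boolP (b' \in V)) => Vb'; last by rewrite mulr0.
    exfalso; apply: nab; congr pair.
      apply: rU => //; first by rewrite inE.
      apply: eq_exist; rewrite -(grngM _ _ ab) abx -abx' grngM//.
    apply: sV => //; first by rewrite inE.
    by apply: eq_exist; rewrite -(gsrcM _ _ ab) abx -abx' gsrcM.
- move=> xUV; rewrite memNset// fsbig1// => -[a b] [/= ab abx].
  rewrite !indicE; case: (boolP (a \in U)) => Ua; last by rewrite mul0r.
  case: (boolP (b \in V)) => Vb; last by rewrite mulr0.
  by exfalso; apply: xUV; exists a, b; split => //; exact: set_mem.
Qed.

End Steinberg.

(* Main.v *)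
Require Import Defs.
From mathcomp Require Import all_boot all_algebra.
From mathcomp Require Import all_classical all_reals all_analysis.
From mathcomp Require Import finmap.

Set Implicit Arguments.
Unset Strict Implicit.
Unset Printing Implicit Defensive.

Import GRing.Theory.
Local Open Scope classical_set_scope.
Local Open Scope ring_scope.

(** Let [W] be a closed invariant proper set of units.  The elements of the
    Steinberg algebra that vanish on the restriction of [G] to [W] form an
    ideal ([vanishing_two_sided]): a product [a b] in the restriction has both
    factors in it, because [W] is invariant.  The ideal is not zero, because a
    unit outside [W] has a compact open bisection around it that misses the
    closed restriction.  So the ideal has finite codimension.  On the other
    hand, finitely many points of the Hausdorff space [G] are separated by
    indicators of compact open bisections, so evaluation at [m] points of the
    restriction maps the quotient onto [K^m].  Hence the restriction has at most
    as many points as the codimension ([restriction_finite]).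

    Applied to orbit closures, which are invariant because source and range are
    open maps, this gives the finiteness of isotropy groups and the dichotomy
    between dense and finite orbits.

    The other three claims rest on one consequence, [open_invariant_meet]: two
    nonempty open invariant sets of units meet.  If they were disjoint, their
    complements would be closed, invariant, proper and would cover the unit
    space, so [G] would be the union of two finite restrictions, and a finite
    groupoid has a finite dimensional Steinberg algebra.
    When the unit space is finite, it is discrete, so two orbits are open
    invariant sets and must coincide. When finite invariant pieces are
    clopen, the closure of an orbit that is not dense would be clopen, and so
    an open invariant set disjoint from its open invariant complement. When
    [G] is second countable, the saturation of each basic open set is open
    and dense, so by a Baire argument some unit lies in all of them, and its
    orbit meets every open set.

    The vanishing functions form an ideal only if the Steinberg algebra is closed
    under convolution ([steinberg_convolution]), which comes down to products of
    compact open bisections being compact open bisections. *)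

(** * Linear spans *)

Lemma linear_spanD (K : fieldType) (V : lmodType K) (B : set V) (u v : V) :
  linear_span B u -> linear_span B v -> linear_span B (u + v).
Proof.
move=> [m [c [b [Bb ->]]]] [n [d [e [Be ->]]]].
exists (m + n)%N,
  (fun k => match fintype.split k with inl i => c i | inr j => d j end),
  (fun k => match fintype.split k with inl i => b i | inr j => e j end); split.
  by move=> k; case: (fintype.split k).
rewrite big_split_ord /=; congr (_ + _); apply: eq_bigr => i _.
  by rewrite (unsplitK (inl i)).
by rewrite (unsplitK (inr i)).
Qed.

Lemma linear_spanZ (K : fieldType) (V : lmodType K) (B : set V) (a : K) (v : V) :
  linear_span B v -> linear_span B (a *: v).
Proof.
move=> [n [c [b [Bb ->]]]]; exists n, (fun i => a * c i), b; split => //.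
by rewrite scaler_sumr; apply: eq_bigr => i _; rewrite scalerA.
Qed.

Lemma linear_span0 (K : fieldType) (V : lmodType K) (B : set V) :
  linear_span B 0.
Proof.
by exists 0%N, (fun=> 0), (fun=> 0); split; [case|rewrite big_ord0].
Qed.

Lemma linear_span_sum (K : fieldType) (V : lmodType K) (B : set V) n
    (F : 'I_n -> V) :
  (forall i, linear_span B (F i)) -> linear_span B (\sum_(i < n) F i).
Proof.
move=> BF; apply: (big_ind (linear_span B)) => //.
  exact: linear_span0.
by move=> u v; exact: linear_spanD.
Qed.

Lemma linear_span_id (K : fieldType) (V : lmodType K) (B : set V) (v : V) :
  B v -> linear_span B v.
Proof.
move=> Bv; exists 1%N, (fun=> 1), (fun=> v); split => //.
by rewrite big_ord_recl big_ord0 addr0 scale1r.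
Qed.

(** * Quotients of function spaces *)

(** Evaluation at points of [S] factors through [A / I] and, by the separation
    hypothesis, is onto [K^m] for any [m] points of [S]; so [m] is at most the
    number of elements spanning [A / I]. *)
Lemma finite_codim_finite_points (K : fieldType) (T : choiceType)
    (A I : set (T -> K^o)) (S : set T) :
  finite_dim_quotient A I ->
  (forall f x, I f -> S x -> f x = 0) ->
  (forall (s : seq T) (x : T), x \in s -> exists f : T -> K^o,
     [/\ A f, f x = 1 & forall y, y \in s -> y != x -> f y = 0]) ->
  finite_set S.
Proof.
move=> [B [finB BA AB]] IS sep; apply: contrapT => infS.
have [s Bs] := (finite_seqP B).1 finB.
have [F FS sF] := infinite_set_fset (size s).+1 infS.
set n := size s in sF; set m := size F in sF.
pose pt (i : 'I_m) := tnth (in_tuple F) i.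
have uF : uniq (in_tuple F) by exact: finmap.fset_uniq.
have Fpt i : pt i \in (F : seq T) by exact: mem_tnth.
pose ev (f : T -> K^o) : 'rV[K]_m := \row_i f (pt i).
pose M : 'M[K]_(n, m) := \matrix_(j, i) (tnth (in_tuple s) j) (pt i).
have evB v : linear_span B v -> (ev v <= M)%MS.
  move=> [k [c [b [Bb ->]]]].
  have -> : ev (\sum_(i < k) c i *: b i) = \sum_(i < k) c i *: ev (b i).
    apply/rowP => i; rewrite mxE summxE fct_sumE; apply: eq_bigr => j _.
    by rewrite !mxE.
  apply: summx_sub => i _; apply: scalemx_sub.
  have /tnthP[j bj] : b i \in in_tuple s by move: (Bb i); rewrite Bs.
  have -> : ev (b i) = row j M by apply/rowP => l; rewrite !mxE bj.
  exact: row_sub.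
(* every basis vector of [K^m] is the evaluation of an element of [A], hence
   of an element of the span of [s] *)
have : (1%:M <= M)%MS.
  apply/row_subP => i.
  have [f [Af fi f0]] := sep F (pt i) (Fpt i).
  have [w Bw Ifw] := AB f Af.
  have -> : row i 1%:M = ev w; last exact: evB.
  apply/rowP => j; rewrite !mxE.
  have -> : w (pt j) = f (pt j).
    have Sj : S (pt j) by apply: FS; exact: Fpt.
    have /eqP := IS _ _ Ifw Sj.
    by rewrite /GRing.add/= /GRing.opp/= subr_eq0 => /eqP.
  case: eqP => [<-|/eqP ij]; first by rewrite fi.
  rewrite f0//; apply: contra ij => /eqP/(tuple_uniqP _ uF) ->.
  exact: eqxx.
move=> /mxrankS; rewrite mxrank1 => /leq_trans/(_ (rank_leq_row M)).
by rewrite leqNgt sF.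
Qed.

(** * Dense sets and a Baire theorem *)

(** Shrink a compact open set into [D 0], then into [D 1], and so on; the
    resulting decreasing sequence of nonempty compact sets has a common point.
    Choosing each set open lets density be used again at the next step. *)
Lemma compact_open_Baire (T : topologicalType) (D : nat -> set T) :
  hausdorff_space T ->
  (forall O x, open O -> O x ->
     exists2 K : set T, compact K /\ open K & K x /\ K `<=` O) ->
  (forall n, open (D n)) -> (forall n, dense (D n)) ->
  [set: T] !=set0 -> \bigcap_n D n !=set0.
Proof.
move=> T2 Tb oD dD [x0 _].
pose P (K : set T) := [/\ compact K, open K & K !=set0].
have step (nK : nat * {K | P K}) :
    exists K' : {K | P K}, sval K' `<=` sval nK.2 `&` D nK.1.
  case: nK => n [K [cK oK K0]] /=.
  have [x [Kx Dx]] := dD n _ K0 oK.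
  have [K' [cK' oK'] [K'x K'K]] := Tb (K `&` D n) x (openI oK (oD n)) (conj Kx Dx).
  have PK' : P K' by split => //; exists x.
  by exists (exist _ _ PK').
have [nxt nxtP] := choice step.
have [K0 [cK0 oK0] [K0x _]] := Tb setT x0 openT I.
have PK0 : P K0 by split => //; exists x0.
pose K := fix K n : {K | P K} :=
  if n is m.+1 then nxt (m, K m) else exist _ K0 PK0.
have KS n : sval (K n.+1) `<=` sval (K n) `&` D n := nxtP (n, K n).
have Kle m n : (m <= n)%N -> sval (K n) `<=` sval (K m).
  elim: n => [|n IH]; first by rewrite leqn0 => /eqP ->.
  rewrite leq_eqVlt => /orP[/eqP <-//|]; rewrite ltnS => /IH Kmn x /KS[Kn _].
  exact: Kmn.
(* a cluster point of the filter generated by the [K n] lies in all of them,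
   because compact sets are closed *)
pose F := filter_from [set: nat] (fun n => sval (K n)).
have FF : ProperFilter F.
  apply: filter_from_proper; last by move=> n _; case: (svalP (K n)).
  apply: filter_from_filter; first by exists 0%N.
  move=> i j _ _; exists (maxn i j) => // x Kx; split.
    exact: (Kle _ _ (leq_maxl i j)).
  exact: (Kle _ _ (leq_maxr i j)).
have [x [_ clx]] : (sval (K 0%N) `&` cluster F) !=set0.
  by apply: cK0; exists 0%N.
exists x => n _.
suff /KS[] : sval (K n.+1) x by [].
have [cKn _ _] := svalP (K n.+1).
apply: (compact_closed T2 cKn) => N Nx.
by apply: clx => //; exists n.+1.
Qed.

Lemma denseP_closure (T : topologicalType) (S : set T) :
  dense S <-> closure S = setT.
Proof.
split=> [dS|cS].
  apply/seteqP; split => // x _ N; rewrite nbhsE => -[V [oV Vx] VN].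
  have [y [Vy Sy]] := dS V (ex_intro _ x Vx) oV.
  by exists y; split => //; exact: VN.
move=> O [x Ox] oO; have : closure S x by rewrite cS.
by move=> /(_ O (open_nbhs_nbhs (conj oO Ox)))[y [Sy Oy]]; exists y.
Qed.

(** * Local homeomorphisms *)

Lemma local_homeomorphism_continuous (X Y : topologicalType) (f : X -> Y) :
  local_homeomorphism f -> continuous f.
Proof.
move=> hf x; have [U [oU Ux _ [g [cf _ _]]]] := hf x.
move: cf; rewrite continuous_open_subspace// => /(_ x); apply.
exact/mem_set.
Qed.

Lemma local_homeomorphism_nbhs (X Y : topologicalType) (f : X -> Y) :
  local_homeomorphism f ->
  forall x (A : set X), nbhs x A -> nbhs (f x) (f @` A).
Proof.
move=> hf x A Ax; have [U [oU Ux ofU [g [_ cg gK]]]] := hf x.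
have fUx : (f @` U) (f x) by exists x.
have : nbhs (f x) (g @^-1` (U `&` A)).
  move: cg; rewrite continuous_open_subspace// => /(_ (f x)); apply.
    exact/mem_set.
  rewrite gK//; apply: filterI => //; exact: open_nbhs_nbhs.
move=> gA; have fU : nbhs (f x) (f @` U) by exact: open_nbhs_nbhs.
apply: filterS2 gA fU => y + [z Uz zy].
by rewrite -zy /= gK// => -[_ Az]; exists z.
Qed.

Lemma local_homeomorphism_open (X Y : topologicalType) (f : X -> Y) :
  local_homeomorphism f -> forall A, open A -> open (f @` A).
Proof.
move=> hf A oA; rewrite openE => _ [x Ax <-].
by apply: local_homeomorphism_nbhs => //; exact: open_nbhs_nbhs.
Qed.

(** * Invariant sets and orbits *)

Section Groupoid.
Variable G : topologicalGroupoidType.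
Implicit Types (x y z : G) (u v : unit_space G) (U V : set G).

Lemma src_rngP x y : src x = rng y <-> gsrc x = grng y.
Proof. by split=> [[]//|xy]; apply: val_inj. Qed.

Lemma rng_rngP x y : rng x = rng y <-> grng x = grng y.
Proof. by split=> [[]//|xy]; apply: val_inj. Qed.

Lemma rngM x y : src x = rng y -> rng (gmul x y) = rng x.
Proof. by move=> /src_rngP xy; apply: val_inj; rewrite /= grngM. Qed.

Lemma srcM x y : src x = rng y -> src (gmul x y) = src y.
Proof. by move=> /src_rngP xy; apply: val_inj; rewrite /= gsrcM. Qed.

Lemma rngV x : rng (ginv x) = src x.
Proof. by apply: val_inj; rewrite /= grngV. Qed.

Lemma srcV x : src (ginv x) = rng x.
Proof. by apply: val_inj; rewrite /= gsrcV. Qed.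

Lemma src_unit u : src (\val u) = u.
Proof. by apply: val_inj; have := set_valP u. Qed.

(** Objects are identity arrows, and the mixin constrains [grng] on units only
    through sources: [u = gsrc u], hence [grng u = grng (gsrc u) = u]. *)
Lemma rng_unit u : rng (\val u) = u.
Proof.
apply: val_inj => /=; have /= <- := set_valP u.
by rewrite grng_src.
Qed.

Lemma gmulVK x y : src x = rng y -> gmul (ginv x) (gmul x y) = y.
Proof.
move=> /src_rngP xy.
by rewrite gmulA ?gsrcV// gmulVx xy gmul_rng.
Qed.

Lemma gmulKV x y : rng x = rng y -> gmul x (gmul (ginv x) y) = y.
Proof.
move=> /rng_rngP xy.
by rewrite gmulA ?grngV ?gsrcV// gmulxV xy gmul_rng.
Qed.

Lemma invariantP (W : set (unit_space G)) :
  invariant_set W <-> forall x, W (src x) <-> W (rng x).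
Proof.
split=> [iW x|iW].
  rewrite -{2}iW; split=> [Wx|[y Wy yx]]; first by exists x.
  rewrite -iW; exists (gmul (ginv x) y) => /=.
    by rewrite srcM// srcV.
  by rewrite rngM ?rngV// srcV.
apply/seteqP; split=> [_ [x Wx <-]|u Wu]; first exact/iW.
by exists (\val u); rewrite /= ?src_unit ?rng_unit.
Qed.

Lemma invariant_setC (W : set (unit_space G)) :
  invariant_set W -> invariant_set (~` W).
Proof.
by move=> /invariantP iW; apply/invariantP => x; split => nW /iW.
Qed.

Lemma invariant_orbit u : invariant_set (groupoid_orbit u).
Proof.
apply/invariantP => x; split=> [[y [yu yx]]|[y [yu yx]]].
  by exists (gmul x y); rewrite srcM ?rngM.
by exists (gmul (ginv x) y); rewrite srcM ?rngM ?rngV ?srcV.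
Qed.

Lemma orbit_refl u : groupoid_orbit u u.
Proof. by exists (\val u); rewrite src_unit rng_unit. Qed.

Lemma orbit_sub (W : set (unit_space G)) u :
  invariant_set W -> W u -> groupoid_orbit u `<=` W.
Proof. by move=> /invariantP iW Wu _ [x [xu <-]]; apply/iW; rewrite xu. Qed.

Lemma orbit_eq u v : groupoid_orbit u v -> groupoid_orbit u = groupoid_orbit v.
Proof.
move=> uv; apply/seteqP; split; last exact: orbit_sub (invariant_orbit u) uv.
apply: orbit_sub (invariant_orbit v) _; have [x [xu xv]] := uv.
by exists (ginv x); rewrite srcV rngV.
Qed.

(** This is what makes vanishing on a restriction an ideal condition: the middle
    unit [gsrc x] is in the orbit of the source and of the range of [x y]. *)
Lemma restriction_factor (W : set (unit_space G)) x y :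
  invariant_set W ->
  gsrc x = grng y -> restriction W (gmul x y) ->
  restriction W x /\ restriction W y.
Proof.
move=> /invariantP iW /src_rngP xy [/=]; rewrite /restriction/= srcM// rngM//.
by move=> Wy Wx; do !split => //; [apply/iW | apply/iW].
Qed.

Lemma orbit_finite (u : unit_space G) (W : set (unit_space G)) :
  invariant_set W -> W u -> finite_set (restriction W) ->
  finite_set (groupoid_orbit u).
Proof.
move=> /invariantP iW Wu /(finite_image (@rng G)); apply: sub_finite_set.
move=> _ [x [xu <-]]; exists x => //; rewrite /restriction/=.
by split=> /=; [|apply/iW]; rewrite xu.
Qed.

(** The smallest invariant set containing [U]. *)
Definition saturation (U : set (unit_space G)) : set (unit_space G) :=
  @rng G @` (@src G @^-1` U).

Lemma sub_saturation (U : set (unit_space G)) : U `<=` saturation U.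
Proof. by move=> u Uu; exists (\val u); rewrite /= ?src_unit ?rng_unit. Qed.

Lemma invariant_saturation (U : set (unit_space G)) :
  invariant_set (saturation U).
Proof.
apply/invariantP => x; split=> [[y Uy yx]|[y Uy yx]].
  by exists (gmul x y); rewrite /= ?srcM// rngM.
by exists (gmul (ginv x) y); rewrite /= ?srcM ?rngM ?rngV ?srcV.
Qed.

Lemma orbit_meets_saturation (U : set (unit_space G)) u :
  saturation U u -> groupoid_orbit u `&` U !=set0.
Proof.
move=> [y Uy yu]; exists (src y); split => //.
by exists (ginv y); rewrite srcV rngV.
Qed.

Lemma unit_space_hausdorff : hausdorff_space G -> hausdorff_space (unit_space G).
Proof.
move=> GT u v uv; apply: val_inj; apply: GT => A B Au Bv.
have cval : continuous (set_val : unit_space G -> G) by exact: initial_continuous.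
have [w [Aw Bw]] := uv _ _ (cval u _ Au) (cval v _ Bv).
by exists (\val w).
Qed.

(** * Ample groupoids *)

Hypothesis hG : ample_hausdorff G.

Lemma ample_T2 : hausdorff_space G.
Proof. by case: hG. Qed.

Lemma rng_homeo : local_homeomorphism (@rng G).
Proof. by case: hG => _ _ []. Qed.

Lemma src_homeo : local_homeomorphism (@src G).
Proof. by case: hG => _ _ []. Qed.

Lemma rng_continuous : continuous (@rng G).
Proof. exact: local_homeomorphism_continuous rng_homeo. Qed.

Lemma src_continuous : continuous (@src G).
Proof. exact: local_homeomorphism_continuous src_homeo. Qed.

(** An arrow carries neighborhoods of its source to neighborhoods of its range,
    since both maps are continuous and open; so it carries limits of points of
    [W] to limits of points of [W]. *)
Lemma invariant_closure (W : set (unit_space G)) :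
  invariant_set W -> invariant_set (closure W).
Proof.
move=> /invariantP iW; apply/invariantP => x; split=> cW N Nx.
  have /cW[w [+ [y Ny yu]]] :=
    local_homeomorphism_nbhs src_homeo (rng_continuous Nx).
  by rewrite -yu => /iW Wy; exists (rng y).
have /cW[w [+ [y Ny yu]]] :=
  local_homeomorphism_nbhs rng_homeo (src_continuous Nx).
by rewrite -yu => /iW Wy; exists (src y).
Qed.

Lemma compact_open_bisection_nbhs (O : set G) x : open O -> O x ->
  exists U, [/\ compact_open_bisection U, U x & U `<=` O].
Proof.
move=> oO Ox; case: hG => _ _ _ [B [_ bB] BC].
have [U [BU Ux] UO] := bB x O (open_nbhs_nbhs (conj oO Ox)).
by exists U; split => //; exact: BC.
Qed.

Definition setprod U V : set G :=
  [set x | exists a b, [/\ U a, V b, gsrc a = grng b & gmul a b = x]].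

Lemma bisection_setprod U V : bisection U -> bisection V ->
  bisection (setprod U V).
Proof.
move=> [rU sU] [rV sV]; split => _ _ /set_mem[a [b [Ua Vb ab <-]]]
    /set_mem[a' [b' [Ua' Vb' ab' <-]]].
  move: ab ab' => /src_rngP ab /src_rngP ab'; rewrite !rngM// => aa'.
  have E : a = a' by apply: rU => //; exact: mem_set.
  rewrite -E; congr gmul; apply: rV; [exact: mem_set|exact: mem_set|].
  by rewrite -ab -ab' E.
move: ab ab' => /src_rngP ab /src_rngP ab'; rewrite !srcM// => bb'.
have E : b = b' by apply: sV => //; exact: mem_set.
rewrite -E; congr (gmul _ b); apply: sU; [exact: mem_set|exact: mem_set|].
by rewrite ab ab' E.
Qed.

(** Near [a b], an arrow [y] factors as [a' (a'^-1 y)] with [a'] close to [a] and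
    [rng a' = rng y], because [rng] is open; by continuity the second factor
    is then close to [b]. *)
Lemma open_setprod U V : open U -> open V -> open (setprod U V).
Proof.
move=> oU oV; rewrite openE => _ [a [b [Ua Vb ab <-]]].
set x := gmul a b.
pose C := [set p : G * G | gsrc p.1 = grng p.2].
have Cax : C (ginv a, x) by rewrite /C/= gsrcV grngM.
have cm := (subspace_continuousP _ _).1 (@gmul_continuous G) _ Cax.
have axb : gmul (ginv a) x = b by rewrite gmulVK//; exact/src_rngP.
have : within C (nbhs (ginv a, x)) [set p | V (gmul p.1 p.2)].
  apply: cm; rewrite /from_subspace /= axb; exact: open_nbhs_nbhs.
rewrite /within/= => -[[A X] [/= /(@ginv_continuous G) Aa Xx] AX].
have AU : nbhs a (ginv @^-1` A `&` U).
  by apply: filterI => //; exact: open_nbhs_nbhs.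
have := local_homeomorphism_nbhs rng_homeo AU.
have -> : rng a = rng x by rewrite rngM//; exact/src_rngP.
move=> /rng_continuous rx; apply: filterS2 Xx rx => y Xy [a' [Aa' Ua'] ay].
have Vy : V (gmul (ginv a') y).
  apply: (AX (ginv a', y)) => //; rewrite /C/= gsrcV; exact/rng_rngP.
exists a', (gmul (ginv a') y); split => //; last by rewrite gmulKV.
by rewrite grngM ?grngV// gsrcV; exact/rng_rngP.
Qed.

(** The product is the image under multiplication of the composable pairs in
    [U `*` V], a closed subset of a compact set because [G] is Hausdorff. *)
Lemma compact_setprod U V : compact U -> compact V -> compact (setprod U V).
Proof.
move=> cU cV; pose C := [set p : G * G | gsrc p.1 = grng p.2].
have clC : closed C.
  have cval : continuous (set_val : unit_space G -> G)
    by exact: initial_continuous.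
  move=> p clp; apply: ample_T2 => A B Aa Bb.
  have h1 : nbhs p.1 (gsrc @^-1` A).
    exact: (continuous_comp (@src_continuous p.1) (@cval _)).
  have h2 : nbhs p.2 (grng @^-1` B).
    exact: (continuous_comp (@rng_continuous p.2) (@cval _)).
  have [] := clp ((gsrc @^-1` A) `*` (grng @^-1` B)).
    by exists (gsrc @^-1` A, grng @^-1` B).
  move=> q [Cq [/= Aq Bq]]; exists (gsrc q.1); split => //.
  by rewrite Cq.
have -> : setprod U V = (fun p : G * G => gmul p.1 p.2) @` ((U `*` V) `&` C).
  apply/seteqP; split=> [_ [a [b [Ua Vb ab <-]]]|_ [[a b] [[Ua Vb] ab] <-]].
    by exists (a, b).
  by exists a, b.
apply: continuous_compact.
  by apply: continuous_subspaceW (@gmul_continuous G); exact: subIsetr.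
by apply: compact_closedI => //; exact: compact_setX.
Qed.

Lemma compact_open_bisection_setprod U V :
  compact_open_bisection U -> compact_open_bisection V ->
  compact_open_bisection (setprod U V).
Proof.
move=> [cU oU bU] [cV oV bV]; split.
- exact: compact_setprod.
- exact: open_setprod.
- exact: bisection_setprod.
Qed.

Lemma open_saturation (U : set (unit_space G)) : open U -> open (saturation U).
Proof.
move=> oU; apply: local_homeomorphism_open rng_homeo _ _.
by apply: open_comp => // x _; exact: src_continuous.
Qed.

Lemma open_separate_seq (s : seq G) x :
  exists O : set G, [/\ open O, O x & forall y, y \in s -> y != x -> ~ O y].
Proof.
exists (~` [set y | y \in [seq y <- s | y != x]]); split.
- rewrite openC; apply: (accessible_finite_set_closed.1 _); last first.
    exact: finite_seq.
  exact/hausdorff_accessible/ample_T2.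
- by rewrite /= mem_filter eqxx.
- by move=> y ys yx; apply; rewrite /= mem_filter yx.
Qed.

End Groupoid.

(** * The Steinberg algebra and its vanishing ideals *)

Lemma scale_funE (K : fieldType) (T : Type) (c : K) (f : T -> K^o) x :
  (c *: f) x = c * f x.
Proof. by []. Qed.

Section SteinbergAlgebra.
Variables (K : fieldType) (G : topologicalGroupoidType).
Hypothesis hG : ample_hausdorff G.
Implicit Types (f g : G -> K^o) (x y : G).

Lemma steinberg_indic (U : set G) :
  compact_open_bisection U -> steinberg (\1_U : G -> K^o).
Proof. by move=> cU; apply: linear_span_id; exists U. Qed.

(** Turns the finitely supported sum of the convolution into a sum over a finite
    index set that can be the same for several functions at once, so that
    bilinearity becomes an exchange of finite sums. *)
Lemma convolution_finite f g x (S : set (G * G)) :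
  finite_set S ->
  (forall p, S p -> gsrc p.1 = grng p.2 /\ gmul p.1 p.2 = x) ->
  (forall p, gsrc p.1 = grng p.2 -> gmul p.1 p.2 = x -> ~ S p -> f p.1 = 0) ->
  convolution f g x = \sum_(p <- fset_set S) (f p.1 * g p.2 : K).
Proof.
move=> finS SP f0; rewrite /convolution -fsbig_finite//.
apply/esym/fsbig_widen => // p [[ab abx] nS] /=.
by rewrite f0// mul0r.
Qed.

(** By bilinearity this reduces to indicators of bisections, whose convolution is
    the indicator of the product bisection.  Bilinearity holds because, for a
    fixed [x], a bisection contains at most one left factor of [x]. *)
Lemma steinberg_convolution f g :
  steinberg f -> steinberg g -> steinberg (convolution f g).
Proof.
have indics k (b : 'I_k -> G -> K^o) :
    (forall i, exists2 U, compact_open_bisection U & b i = \1_U) ->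
    exists U : 'I_k -> set G,
      forall i, compact_open_bisection (U i) /\ b i = \1_(U i).
  move=> hb.
  have hb' i : exists U, compact_open_bisection U /\ b i = \1_U.
    by have [U cU bU] := hb i; exists U.
  by have [U hU] := choice hb'; exists U.
move=> [n [c [b [/indics[U hU] fE]]]] [m [d [e [/indics[V hV] gE]]]].
have -> : convolution f g =
    \sum_(i < n) \sum_(j < m) (c i * d j) *: \1_(setprod (U i) (V j)).
  apply/funext => x.
  (* the factorizations of [x] with left factor in [U i]: at most one *)
  pose S i : set (G * G) :=
    [set p | [/\ U i p.1, gsrc p.1 = grng p.2 & gmul p.1 p.2 = x]].
  have finS : finite_set (\bigcup_i S i).
    apply: bigcup_finite => // i _.
    have [[_ _ [rU _]] _] := hU i.
    have [[p Sp]|S0] := pselect (S i !=set0).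
      apply: (@sub_finite_set _ _ [set p]) => // -[a2 b2] [/= Ua2 ab2 abx2].
      case: p Sp => a1 b1 [/= Ua1 ab1 abx1].
      have E : a2 = a1.
        apply: rU; [exact: mem_set|exact: mem_set|].
        by apply/rng_rngP; rewrite -(grngM _ _ ab2) -(grngM _ _ ab1) abx1 abx2.
      congr pair => //.
      have h1 : src a1 = rng b1 by apply/src_rngP.
      have h2 : src a2 = rng b2 by apply/src_rngP.
      by rewrite -(gmulVK h1) -(gmulVK h2) abx1 abx2 E.
    apply: (@sub_finite_set _ _ set0) => // p Sp.
    by exfalso; apply: S0; exists p.
  have SP p : (\bigcup_i S i) p -> gsrc p.1 = grng p.2 /\ gmul p.1 p.2 = x.
    by move=> [i _ []].
  have U0 i p : gsrc p.1 = grng p.2 -> gmul p.1 p.2 = x ->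
      ~ (\bigcup_i S i) p -> (\1_(U i) p.1 : K) = 0.
    move=> ab abx nS; rewrite indicE memNset// => Up.
    by apply: nS; exists i.
  rewrite (convolution_finite _ finS SP); last first.
    move=> p ab abx nS; rewrite fE fct_sumE big1// => i _.
    have [_ ->] := hU i.
    by rewrite scale_funE (U0 i)// mulr0.
  rewrite fct_sumE.
  under [RHS]eq_bigr do rewrite fct_sumE.
  (* expand both linear combinations and sum over the factorizations first *)
  transitivity (\sum_(i < n) \sum_(j < m) \sum_(p <- fset_set (\bigcup_i S i))
      (c i * d j) * (\1_(U i) p.1 * \1_(V j) p.2) : K).
    transitivity (\sum_(p <- fset_set (\bigcup_i S i)) \sum_(i < n)
       \sum_(j < m) (c i * d j) * (\1_(U i) p.1 * \1_(V j) p.2) : K).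
      apply: eq_bigr => p _; rewrite fE gE !fct_sumE mulr_suml.
      apply: eq_bigr => i _; rewrite mulr_sumr; apply: eq_bigr => j _.
      have [_ ->] := hU i; have [_ ->] := hV j.
      by rewrite !scale_funE mulrACA.
    rewrite exchange_big; apply: eq_bigr => i _.
    by rewrite exchange_big.
  apply: eq_bigr => i _; apply: eq_bigr => j _.
  rewrite -mulr_sumr -(convolution_finite (f := \1_(U i)) _ finS SP) //.
    have [[_ _ bU] _] := hU i; have [[_ _ bV] _] := hV j.
    by rewrite (convolution_indic K bU bV).
  by move=> p ab abx nS; exact: U0.
apply: linear_span_sum => i; apply: linear_span_sum => j.
apply: linear_spanZ; apply: steinberg_indic.
by apply: compact_open_bisection_setprod => //; [case: (hU i)|case: (hV j)].
Qed.

Definition vanishing_ideal (W : set (unit_space G)) : set (G -> K^o) :=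
  [set f | steinberg f /\ forall x, restriction W x -> f x = 0].

Lemma vanishing_two_sided (W : set (unit_space G)) : invariant_set W ->
  two_sided_ideal (@convolution K G) (@steinberg K G) (vanishing_ideal W).
Proof.
move=> iW; split.
- by move=> f [].
- by split => //; exact: linear_span0.
- move=> f g [Af f0] [Ag g0]; split; first exact: linear_spanD.
  by move=> x Wx; rewrite /GRing.add/= f0// g0// addr0.
- move=> c f [Af f0]; split; first exact: linear_spanZ.
  by move=> x Wx; rewrite scale_funE f0// mulr0.
- move=> f g Af [Ag g0]; split; first exact: steinberg_convolution.
  move=> x Wx; rewrite /convolution fsbig1// => -[a b] [/= ab abx].
  rewrite -abx in Wx; have [_ Wb] := restriction_factor iW ab Wx.
  by rewrite g0// mulr0.
- move=> f g Af [Ag g0]; split; first exact: steinberg_convolution.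
  move=> x Wx; rewrite /convolution fsbig1// => -[a b] [/= ab abx].
  rewrite -abx in Wx; have [Wa _] := restriction_factor iW ab Wx.
  by rewrite g0// mul0r.
Qed.

(** A finite [G] has finitely many subsets, hence finitely many indicators. *)
Lemma finite_groupoid_finite_dim :
  finite_set [set: G] -> finite_dim (@steinberg K G).
Proof.
move=> finG; exists [set f | exists2 U : set G,
                 compact_open_bisection U & f = \1_U] => //.
apply: (@sub_finite_set _ _ ((fun F : {fset G} => \1_[set` F]) @`
   [set` fpowerset (fset_set [set: G])])); last first.
  by apply: finite_image; exact: finite_fset.
move=> _ [U _ ->]; have finU : finite_set U by exact: sub_finite_set finG.
exists (fset_set U); last by rewrite fset_setK.
by rewrite /= fpowersetE -fset_set_sub.
Qed.

(** * Dynamics when the Steinberg algebra is just infinite *)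

Hypothesis hA : just_infinite (@convolution K G) (@steinberg K G).

Lemma groupoid_infinite : infinite_set [set: G].
Proof. by move=> finG; apply: hA.1; exact: finite_groupoid_finite_dim. Qed.

Lemma groupoid_nonempty : [set: G] !=set0.
Proof.
apply/set0P/eqP => G0; apply: groupoid_infinite.
by rewrite G0.
Qed.

(** The ideal of functions vanishing on the restriction has finite codimension,
    which bounds the number of points of the restriction. *)
Lemma restriction_finite (W : set (unit_space G)) :
  closed W -> invariant_set W -> W <> setT -> finite_set (restriction W).
Proof.
move=> clW iW nW.
have [u nWu] : exists u, ~ W u.
  by apply/existsNP => h; apply: nW; apply/seteqP; split.
have oC : open (~` (restriction W)).
  rewrite openC; apply: closedI; apply: closed_comp => //.
    by move=> x _; exact: src_continuous.
  by move=> x _; exact: rng_continuous.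
(* a bisection around a unit outside [W] shows that the ideal is not zero *)
have Cu : (~` restriction W) (\val u).
  by rewrite /restriction /= src_unit => -[].
have [U [cU Uu UC]] := compact_open_bisection_nbhs hG oC Cu.
apply: (@finite_codim_finite_points K G (@steinberg K G) (vanishing_ideal W)).
- apply: hA.2; first exact: vanishing_two_sided.
  exists (\1_U).
    split; first exact: steinberg_indic.
    by move=> x Wx; rewrite indicE memNset// => /UC.
  apply/eqP => /(congr1 (fun f => f (\val u))).
  rewrite indicE mem_set// => /eqP; rewrite /GRing.zero/= oner_eq0; exact/negP.
- by move=> f x [_ +] Wx; apply.
- move=> s x _; have [V [oV Vx Vs]] := open_separate_seq hG s x.
  have [B [cB Bx BV]] := compact_open_bisection_nbhs hG oV Vx.
  exists (\1_B); split; first exact: steinberg_indic.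
    by rewrite indicE mem_set.
  by move=> y ys yx; rewrite indicE memNset// => /BV; exact: Vs.
Qed.

(** Otherwise every arrow avoids [U] or avoids [V], so [G] is covered by the
    restrictions to the two complements, which are finite. *)
Lemma open_invariant_meet (U V : set (unit_space G)) :
  open U -> open V -> invariant_set U -> invariant_set V ->
  U !=set0 -> V !=set0 -> U `&` V !=set0.
Proof.
move=> oU oV iU iV [u Uu] [v Vv]; apply: contrapT => UV0.
apply: groupoid_infinite.
have finC (W : set (unit_space G)) w : open W -> invariant_set W -> W w ->
    finite_set (restriction (~` W)).
  move=> oW iW Ww; apply: restriction_finite; first by rewrite closedC.
    exact: invariant_setC.
  by move=> CW; have : (~` W) w by rewrite CW.
apply: (@sub_finite_set _ _ (restriction (~` U) `|` restriction (~` V))).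
  move=> x _; rewrite /restriction /=.
  have [Ux|nUx] := pselect (U (src x)).
    right; have nVx : ~ V (src x) by move=> Vx; apply: UV0; exists (src x).
    by split => // /((invariantP V).1 iV).
  by left; split => // /((invariantP U).1 iU).
by rewrite finite_setU; split; [exact: (finC U u)|exact: (finC V v)].
Qed.

Lemma saturation_dense (U : set (unit_space G)) :
  open U -> U !=set0 -> dense (saturation U).
Proof.
move=> oU [u Uu] V [v Vv] oV.
have [] := @open_invariant_meet (saturation U) (saturation V).
- exact: (open_saturation hG).
- exact: (open_saturation hG).
- exact: invariant_saturation.
- exact: invariant_saturation.
- by exists u; exact: sub_saturation.
- by exists v; exact: sub_saturation.
move=> w [iUw [y Vy yw]]; exists (src y); split => //.
by apply/(invariantP _).1; [exact: invariant_saturation|rewrite yw].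
Qed.

(** The orbit of [u] meets [U] exactly when [u] is in the saturation of [U].
    Saturations of the countably many sources of basic sets are open and dense,
    so their preimages in [G] have a common point, whose source has an orbit
    that meets every open set. *)
Lemma second_countable_dense_orbit :
  @second_countable G -> exists u : unit_space G, dense (groupoid_orbit u).
Proof.
move=> [B cB [oB bB]].
have /countable_injP[h hinj] := cB.
(* [D n] is all of [G] when no nonempty basic set has code [n] *)
pose D n : set G := [set x | forall U, B U -> U !=set0 -> h U = n ->
  saturation (@src G @` U) (src x)].
have DE n : D n = setT \/
    exists U, [/\ B U, U !=set0 & D n = @src G @^-1` saturation (@src G @` U)].
  have [[U [BU U0 hU]]|nU] := pselect (exists U, [/\ B U, U !=set0 & h U = n]).
    right; exists U; split => //; apply/seteqP; split=> x /= Dx.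
      exact: Dx.
    move=> V BV V0 hV; suff -> : V = U by [].
    by apply: hinj; [exact: mem_set|exact: mem_set|rewrite hV].
  left; apply/seteqP; split => // x _ U BU U0 hU.
  by exfalso; apply: nU; exists U.
have osrc (U : set G) : open U -> open (@src G @` U).
  exact: (local_homeomorphism_open (src_homeo hG)).
have [||||x Dx] := @compact_open_Baire G D (ample_T2 hG).
- move=> W x oW Wx; have [U [[cU oU _] Ux UW]] :=
    compact_open_bisection_nbhs hG oW Wx.
  by exists U.
- move=> n; have [->|[U [BU _ ->]]] := DE n; first exact: openT.
  apply: open_comp; first by move=> x _; exact: src_continuous.
  by apply: (open_saturation hG); apply: osrc; exact: oB.
- move=> n; have [->|[U [BU [y Uy] ->]]] := DE n.
    by move=> W [x Wx] _; exists x.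
  move=> W [x Wx] oW.
  have [||||_ [[z Wz <-] sz]] := @saturation_dense (@src G @` U) _ _ (@src G @` W).
  + by apply: osrc; exact: oB.
  + by exists (src y), y.
  + by exists (src x), x.
  + exact: osrc.
  by exists z.
- exact: groupoid_nonempty.
exists (src x) => V [v Vv] oV.
have oV' : open (@src G @^-1` V).
  by apply: open_comp => // y _; exact: src_continuous.
have Vv' : (@src G @^-1` V) (\val v) by rewrite /= src_unit.
have [U [BU Uv] UV] := bB (\val v) _ (open_nbhs_nbhs (conj oV' Vv')).
have U0 : U !=set0 by exists (\val v).
have [w [xw [y Uy yw]]] := orbit_meets_saturation (Dx _ I _ BU U0 erefl).
by exists w; split => //; rewrite -yw; exact: UV.
Qed.

End SteinbergAlgebra.

Theorem proposition4p8 (K : fieldType) (G : topologicalGroupoidType)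
    (hG : ample_hausdorff G)
    (hA : just_infinite (@convolution K G) (@steinberg K G)) :
  (forall W : set (unit_space G),
      W !=set0 -> closed W -> invariant_set W -> W <> setT ->
      finite_set (restriction W)) /\
  (forall u : unit_space G,
      closure (groupoid_orbit u) <> setT -> finite_set (isotropy u)) /\
  (forall u : unit_space G, dense (groupoid_orbit u) \/ finite_set (groupoid_orbit u)) /\
  (finite_set [set: unit_space G] -> transitive_groupoid G) /\
  (@second_countable G -> exists u : unit_space G, dense (groupoid_orbit u)) /\
  (property_FIC G -> minimal_groupoid G).
Proof.
have cl_orbit (u : unit_space G) : closure (groupoid_orbit u) u.
  by apply: subset_closure; exact: orbit_refl.
have icl (u : unit_space G) : invariant_set (closure (groupoid_orbit u)).
  exact: (invariant_closure hG (invariant_orbit u)).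
have fin_cl (u : unit_space G) : closure (groupoid_orbit u) <> setT ->
    finite_set (restriction (closure (groupoid_orbit u))).
  by apply: (restriction_finite hG hA) => //; exact: closed_closure.
have meet := open_invariant_meet hG hA.
split; [|split; [|split; [|split; [|split]]]].
- by move=> W _ clW iW nW; exact: (restriction_finite hG hA).
- move=> u /fin_cl; apply: sub_finite_set => x [xu ux].
  by rewrite /restriction/= xu ux.
- move=> u; have [?|nd] := pselect (dense (groupoid_orbit u)); first by left.
  right; apply: (orbit_finite (icl u) (cl_orbit u)).
  by apply: fin_cl => /denseP_closure.
- move=> finU.
  have oall (W : set (unit_space G)) : open W.
    rewrite -closedC; apply: (accessible_finite_set_closed.1 _).
      exact/hausdorff_accessible/unit_space_hausdorff/ample_T2.
    exact: sub_finite_set finU.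
  have [x _] := groupoid_nonempty hA.
  exists (groupoid_orbit (src x)); split; first by exists (src x).
  move=> _ [u _ <-].
  have [w [xw uw]] := meet _ _ (oall (groupoid_orbit (src x)))
    (oall (groupoid_orbit u)) (invariant_orbit _) (invariant_orbit _)
    (ex_intro _ _ (orbit_refl _)) (ex_intro _ _ (orbit_refl _)).
  exact: etrans (orbit_eq xw) (esym (orbit_eq uw)).
- exact: second_countable_dense_orbit hG hA.
- move=> FIC u; apply/denseP_closure; apply: contrapT => nd.
  have clO : clopen (closure (groupoid_orbit u)).
    by apply: FIC; [exists u|exact: icl|exact: fin_cl].
  have [v nv] : exists v, ~ closure (groupoid_orbit u) v.
    by apply/existsNP => h; apply: nd; apply/seteqP; split.
  have [||||||w [cw ncw]] := meet (closure (groupoid_orbit u))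
    (~` closure (groupoid_orbit u)) => //.
  + exact: clO.1.
  + by rewrite openC; exact: clO.2.
  + exact: invariant_setC.
  + by exists u.
  + by exists v.
Qed.
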